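(* Let $KT$ be a Kragujevac tree with $n$ vertices, of degree $d$, with branches $\gamma_i\cong R_{k_i}$, $i=1,2,\ldots,d$. Let $p$ be a positive real number. Then $$A_p(KT)=\left[\frac{n-d-1}{2}+\sum_{i=1}^{d}\left(k_i(k_i-1)^p+|k_i-d+1|^p\right)\right]^{\frac{1}{p}}.$$
   Context: For a positive real number $p$, the general Albertson irregularity index of a connected graph $G$ is $A_p(G)=\left(\sum_{uv\in E(G)}|d(u)-d(v)|^p\right)^{1/p}$, where $d(v)$ is the degree of vertex $v$. Let $P_3$ be the 3-vertex tree (path), rooted at one of its terminal vertices. For $k=2,3,\ldots$, the rooted tree $R_k$ is constructed by identifying the roots of $k$ copies of $P_3$; the vertex obtained by this identification is the root of $R_k$. Let $d\geq 2$ be an integer and let $\gamma_1,\ldots,\gamma_d\in\{R_2,R_3,\ldots\}$ be rooted trees. A Kragujevac tree $KT$ is a tree possessing a vertex of degree $d$ (the central vertex) adjacent to the roots of $\gamma_1,\ldots,\gamma_d$ (so $KT$ consists of the central vertex, the disjoint trees $\gamma_1,\ldots,\gamma_d$, and the edges from the central vertex to their roots). The number $d$ is the degree of $KT$, and $\gamma_1,\ldots,\gamma_d$ are its branches; branches may be mutually isomorphic. *)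

(* Defs.v *)
From mathcomp Require Import all_boot all_order all_algebra.
From mathcomp Require Import reals exp.

Set Implicit Arguments.
Unset Strict Implicit.
Unset Printing Implicit Defensive.

Import Order.TTheory GRing.Theory Num.Theory.

Record sgraph := SGraph {
  vertex :> finType;
  adj : rel vertex;
  adj_sym : symmetric adj;
  adj_irr : irreflexive adj }.

Arguments adj {s}.

Definition deg (G : sgraph) (v : G) : nat := #|[set w | adj v w]|.

Definition connected_graph (G : sgraph) : Prop :=
  0 < #|G| /\ forall u v : G, connect adj u v.

(* [:: u; v] is a uniq cycle of adj whenever u and v are adjacent, hence the
   lower bound on the size. *)
Definition acyclic_graph (G : sgraph) : Prop :=
  forall c : seq G, 2 < size c -> ~ ucycle adj c.

Definition is_tree (G : sgraph) : Prop := connected_graph G /\ acyclic_graph G.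

Definition is_giso (G H : sgraph) (f : G -> H) : Prop :=
  bijective f /\ forall u v, adj (f u) (f v) = adj u v.

Definition giso (G H : sgraph) : Prop := exists f : G -> H, is_giso f.

Record rooted_graph := RootedGraph {
  rooted_sgraph :> sgraph;
  root_of : rooted_sgraph }.

Arguments root_of : clear implicits.

Definition rgiso (G H : rooted_graph) : Prop :=
  exists2 f : G -> H, is_giso f & f (root_of G) = root_of H.

Section Path3.
Definition path3_adj : rel 'I_3 :=
  fun i j => (j == i.+1 :> nat) || (i == j.+1 :> nat).

Lemma path3_sym : symmetric path3_adj.
Proof. by move=> i j; rewrite /path3_adj orbC. Qed.

Lemma path3_irr : irreflexive path3_adj.
Proof. by move=> i; rewrite /path3_adj orbb ltn_eqF. Qed.

Definition P3 : rooted_graph := @RootedGraph (SGraph path3_sym path3_irr) (ord0 : 'I_3).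
End Path3.

(* k copies of H with their roots identified: None is the common root, and
   Some (i, v) is the non-root vertex v of the i-th copy. *)
Section Bouquet.
Variables (k : nat) (H : rooted_graph).

Definition bouquet_vertex : finType := option ('I_k * {v : H | v != root_of H}).

Definition bouquet_adj : rel bouquet_vertex := fun x y =>
  match x, y with
  | None, None => false
  | None, Some v => adj (root_of H) (val v.2)
  | Some u, None => adj (val u.2) (root_of H)
  | Some u, Some v => (u.1 == v.1) && adj (val u.2) (val v.2)
  end.

Lemma bouquet_sym : symmetric bouquet_adj.
Proof.
by case=> [u|] [v|] //=; rewrite adj_sym // eq_sym.
Qed.

Lemma bouquet_irr : irreflexive bouquet_adj.
Proof. by case=> [u|] //=; rewrite adj_irr andbF. Qed.

Definition bouquet : rooted_graph :=
  @RootedGraph (SGraph bouquet_sym bouquet_irr) (None : bouquet_vertex).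
End Bouquet.

Definition Rtree (k : nat) : rooted_graph := bouquet k P3.

(* The disjoint union of the gamma i, together with a central vertex None
   joined to each of their roots. *)
Section CentralJoin.
Variables (d : nat) (gamma : 'I_d -> rooted_graph).

Definition join_vertex : finType := option {i : 'I_d & gamma i}.

Definition join_adj : rel join_vertex := fun x y =>
  match x, y with
  | None, None => false
  | None, Some v => tagged v == root_of (gamma (tag v))
  | Some u, None => tagged u == root_of (gamma (tag u))
  | Some u, Some v => (tag u == tag v) && adj (tagged u) (tagged_as u v)
  end.

Lemma join_sym : symmetric join_adj.
Proof.
case=> [[i u]|] [[j v]|] //=; have [e|] := eqVneq i j => //=.
by subst j; rewrite /tagged_as /=; case: eqP => // e; rewrite [e]eq_axiomK adj_sym.
Qed.

Lemma join_irr : irreflexive join_adj.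
Proof.
case=> [[i u]|] //=; rewrite eqxx /= /tagged_as /=.
by case: eqP => // e; rewrite [e]eq_axiomK adj_irr.
Qed.

Definition central_join : sgraph := SGraph join_sym join_irr.
End CentralJoin.

Definition kragujevac (d : nat) (gamma : 'I_d -> rooted_graph) (KT : sgraph) : Prop :=
  [/\ 2 <= d,
      forall i, exists2 k, 2 <= k & rgiso (gamma i) (Rtree k),
      is_tree KT &
      giso KT (central_join gamma)].

Local Open Scope ring_scope.

(* The condition on enum_rank selects one of the two orientations of each
   edge, so that every edge contributes exactly once. *)
Definition albertson (R : realType) (p : R) (G : sgraph) : R :=
  (\sum_(u : G) \sum_(v : G | adj u v && (enum_rank u < enum_rank v)%N)
     `|(deg u)%:R - (deg v)%:R| `^ p) `^ p^-1.

(* Main.v *)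
(** Summing over ordered pairs of adjacent vertices counts every edge twice and
    does not depend on an enumeration of the vertices, so that the sum is
    invariant under isomorphism.  In the join, every vertex of a branch keeps
    its degree, except for the root, which gains one: the sum therefore splits
    into one contribution for each branch. *)
Require Import Defs.
From HB Require Import structures.
From mathcomp Require Import all_boot all_order all_algebra.
From mathcomp Require Import reals exp.
From mathcomp Require Import ring zify.

Set Implicit Arguments.
Unset Strict Implicit.
Unset Printing Implicit Defensive.

Import Order.TTheory GRing.Theory Num.Theory.
Local Open Scope ring_scope.

(** The operator stays abstract, here and in the other lemmas on big operators, because the same
    splitting serves for degrees, which are sums in [nat], and for sums of weights. *)
Lemma big_option (T : Type) (idx : T) (op : Monoid.com_law idx) (I : finType)
    (P : pred (option I)) (F : option I -> T) :
  \big[op/idx]_(x | P x) F x =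
  op (if P None then F None else idx) (\big[op/idx]_(i | P (Some i)) F (Some i)).
Proof.
rewrite big_mkcond (bigD1 None) //= -big_mkcondr; congr (op _ _).
rewrite (reindex_omap Some id) => [|[]//].
by apply: eq_bigl => i; rewrite /= eqxx andbT.
Qed.

Lemma deg_sum (G : sgraph) (v : G) : deg v = (\sum_(w | adj v w) 1)%N.
Proof. by rewrite /deg -sum1dep_card. Qed.

(** The degree that [v] acquires once [H] is a branch of a join: the extra unit is the edge from the
    root to the central vertex. *)
Definition root_deg (H : rooted_graph) (v : H) : nat := deg v + (v == root_of H).

(* The ordered sum: every edge contributes both w (f u) (f v) and w (f v) (f u). *)
Definition arc_sum (R : nmodType) (w : nat -> nat -> R) (G : sgraph) (f : G -> nat) : R :=
  \sum_u \sum_(v | adj u v) w (f u) (f v).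

Lemma deg_iso (G H : sgraph) (f : G -> H) v : is_giso f -> deg (f v) = deg v.
Proof.
case=> fb fadj; rewrite !deg_sum (reindex f) /=; last exact: onW_bij.
by apply: eq_bigl => w; rewrite fadj.
Qed.

Lemma root_deg_iso (G H : rooted_graph) (f : G -> H) v :
  is_giso f -> f (root_of G) = root_of H -> root_deg (f v) = root_deg v.
Proof.
move=> fiso frt; rewrite /root_deg deg_iso // -frt.
by case: fiso => /bij_inj/inj_eq ->.
Qed.

Lemma arc_sum_iso (R : nmodType) (w : nat -> nat -> R) (G H : sgraph) (f : G -> H)
    (a : G -> nat) (b : H -> nat) :
  is_giso f -> (forall v, b (f v) = a v) -> arc_sum w b = arc_sum w a.
Proof.
case=> fb fadj ab; rewrite /arc_sum (reindex f) /=; last exact: onW_bij.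
apply: eq_bigr => u _; rewrite (reindex f) /=; last exact: onW_bij.
by apply: eq_big => v; rewrite ?fadj ?ab.
Qed.

(** Split the arcs according to whether [enum_rank] increases or not; reversing arcs exchanges the
    two classes, and commutativity of [w] makes their sums equal. *)
Lemma half_arc_sum (R : nmodType) (G : sgraph) (w : nat -> nat -> R) (f : G -> nat) :
  commutative w ->
  (\sum_(u : G) \sum_(v : G | adj u v && (enum_rank u < enum_rank v)%N)
     w (f u) (f v)) *+ 2 = arc_sum w f.
Proof.
move=> wC; rewrite /arc_sum.
under [RHS]eq_bigr => u _ do
  rewrite (bigID (fun v => (enum_rank u < enum_rank v)%N)) /=.
rewrite big_split /= mulr2n; congr (_ + _).
rewrite (exchange_big_dep predT) //=; apply: eq_bigr => u _.
apply: eq_big => v; last by rewrite wC.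
(* The complementary class is given by [<=] on ranks; equal ranks would force [u = v], which
   irreflexivity excludes. *)
rewrite -leqNgt [(enum_rank v <= _)%N]leq_eqVlt [adj v u]adj_sym.
by case: eqP => [/ord_inj/enum_rank_inj ->|//]; rewrite adj_irr.
Qed.

Section Join.
Variables (d : nat) (gamma : 'I_d -> rooted_graph).
Let J := central_join gamma.

Definition of_branch i (u : gamma i) : J := Some (Tagged gamma u).

Lemma big_join (T : Type) (idx : T) (op : Monoid.com_law idx)
    (P : pred J) (F : J -> T) :
  \big[op/idx]_(x | P x) F x =
  op (if P None then F None else idx)
     (\big[op/idx]_i \big[op/idx]_(u : gamma i | P (of_branch u)) F (of_branch u)).
Proof. by rewrite big_option sig_big_dep; congr (op _ _); apply: eq_big => [[]|[]]. Qed.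

Lemma big_adj_center (T : Type) (idx : T) (op : Monoid.com_law idx) (F : J -> T) :
  \big[op/idx]_(y | adj (None : J) y) F y =
  \big[op/idx]_i F (of_branch (root_of (gamma i))).
Proof.
rewrite big_join /= Monoid.mul1m; apply: eq_bigr => i _.
by rewrite big_pred1_eq.
Qed.

Lemma big_adj_branch (T : Type) (idx : T) (op : Monoid.com_law idx) (F : J -> T) i (u : gamma i) :
  \big[op/idx]_(y | adj (of_branch u) y) F y =
  op (if u == root_of (gamma i) then F None else idx)
     (\big[op/idx]_(v | adj u v) F (of_branch v)).
Proof.
rewrite big_join /=; congr (op _ _).
(* Adjacency between two branch vertices requires equal tags, so only branch [i] contributes. *)
rewrite (bigD1 i) //= [X in op _ X]big1 ?Monoid.mulm1.
  by apply: eq_bigl => v; rewrite eqxx tagged_asE.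
by move=> j /negPf ji; apply: big_pred0 => v; rewrite eq_sym ji.
Qed.

Lemma deg_center : deg (None : J) = d.
Proof. by rewrite deg_sum big_adj_center sum1_card card_ord. Qed.

Lemma deg_of_branch i (u : gamma i) : deg (of_branch u) = root_deg u.
Proof. by rewrite deg_sum big_adj_branch -deg_sum /root_deg addnC; case: eqP. Qed.

(** The edge from the centre to a root is met twice, once among the arcs leaving the centre and once
    among those leaving the root; all other arcs stay inside a branch. *)
Lemma arc_sum_join (R : nmodType) (w : nat -> nat -> R) :
  commutative w ->
  arc_sum w (@deg J) =
  \sum_i (w d (root_deg (root_of (gamma i))) *+ 2 + arc_sum w (@root_deg (gamma i))).
Proof.
move=> wC; rewrite /arc_sum big_join /= big_adj_center deg_center -big_split /=.
apply: eq_bigr => i _; rewrite deg_of_branch mulr2n -addrA; congr (_ + _).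
under eq_bigr => u _ do rewrite big_adj_branch deg_center deg_of_branch.
rewrite big_split /= -big_mkcond big_pred1_eq wC; congr (_ + _).
by apply: eq_bigr => u _; apply: eq_bigr => v _; rewrite deg_of_branch.
Qed.

Lemma card_join : #|J| = (\sum_i #|gamma i|).+1.
Proof. by rewrite card_option card_tagged sumnE big_map big_enum. Qed.

End Join.

Section Rtree.
Variable k : nat.

Definition Rmiddle (i : 'I_k) : Rtree k :=
  Some (i, Sub (Ordinal (isT : 1 < 3)%N : P3) isT).
Definition Rleaf (i : 'I_k) : Rtree k :=
  Some (i, Sub (Ordinal (isT : 2 < 3)%N : P3) isT).

Lemma big_Rtree (T : Type) (idx : T) (op : Monoid.com_law idx)
    (P : pred (Rtree k)) (F : Rtree k -> T) :
  \big[op/idx]_(x | P x) F x =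
  op (if P None then F None else idx)
     (\big[op/idx]_i op (if P (Rmiddle i) then F (Rmiddle i) else idx)
                        (if P (Rleaf i) then F (Rleaf i) else idx)).
Proof.
rewrite big_option; congr (op _ _).
rewrite big_mkcond.
transitivity (\big[op/idx]_(i < k) \big[op/idx]_(v : {v : P3 | v != root_of P3})
                if P (Some (i, v)) then F (Some (i, v)) else idx).
  by rewrite pair_bigA; apply: eq_bigr => [[]].
apply: eq_bigr => i _.
(* To enumerate the non-root vertices of [P3], the summand is extended to all of ['I_3] through
   [insubd]. The default [m] is harmless: it would be used only at the root, which the sum omits. *)
pose m : {v : P3 | v != root_of P3} := Sub (Ordinal (isT : 1 < 3)%N : P3) isT.
pose l : {v : P3 | v != root_of P3} := Sub (Ordinal (isT : 2 < 3)%N : P3) isT.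
pose G v := if P (Some (i, v)) then F (Some (i, v)) else idx.
transitivity (\big[op/idx]_(v : {v : P3 | v != root_of P3}) G (insubd m (\val v))).
  by apply: eq_bigr => v _; rewrite valKd.
rewrite -(big_sub [pred v | v != root_of P3] (fun v => G (insubd m v))).
rewrite big_mkcond /= !big_ord_recl big_ord0 /= Monoid.mul1m Monoid.mulm1.
have Gval (v : P3) x : v = val x -> G (insubd m v) = G x by move=> ->; rewrite valKd.
by rewrite (Gval _ m) ?(Gval _ l) //; apply: val_inj.
Qed.

Lemma card_Rtree : #|Rtree k| = k.*2.+1.
Proof.
rewrite -sum1_card big_Rtree /= sum_nat_const card_ord; lia.
Qed.

Lemma big_adj_root (T : Type) (idx : T) (op : Monoid.com_law idx) (F : Rtree k -> T) :
  \big[op/idx]_(y | adj (None : Rtree k) y) F y = \big[op/idx]_i F (Rmiddle i).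
Proof.
by rewrite big_Rtree /= Monoid.mul1m; apply: eq_bigr => i _; rewrite Monoid.mulm1.
Qed.

Lemma big_adj_middle (T : Type) (idx : T) (op : Monoid.com_law idx) (F : Rtree k -> T) i :
  \big[op/idx]_(y | adj (Rmiddle i) y) F y = op (F None) (F (Rleaf i)).
Proof.
rewrite big_Rtree /=; congr (op _ _); rewrite (bigD1 i) //= eqxx Monoid.mul1m.
by rewrite big1 ?Monoid.mulm1 // => j /negPf ji; rewrite eq_sym ji Monoid.mulm1.
Qed.

Lemma big_adj_leaf (T : Type) (idx : T) (op : Monoid.com_law idx) (F : Rtree k -> T) i :
  \big[op/idx]_(y | adj (Rleaf i) y) F y = F (Rmiddle i).
Proof.
rewrite big_Rtree /= Monoid.mul1m (bigD1 i) //= eqxx Monoid.mulm1.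
by rewrite big1 ?Monoid.mulm1 // => j /negPf ji; rewrite eq_sym ji Monoid.mulm1.
Qed.

Lemma root_deg_root : root_deg (root_of (Rtree k)) = k.+1.
Proof. by rewrite /root_deg eqxx deg_sum big_adj_root sum1_card card_ord addn1. Qed.

Lemma root_deg_middle i : root_deg (Rmiddle i) = 2%N.
Proof. by rewrite /root_deg deg_sum big_adj_middle. Qed.

Lemma root_deg_leaf i : root_deg (Rleaf i) = 1%N.
Proof. by rewrite /root_deg deg_sum big_adj_leaf. Qed.

(** Each copy of [P3] has an edge from root to middle, with degrees [k.+1] and [2], and a pendant
    edge, with degrees [2] and [1]; both orientations count. *)
Lemma arc_sum_Rtree (R : nmodType) (w : nat -> nat -> R) :
  commutative w ->
  arc_sum w (@root_deg (Rtree k)) = (w k.+1 2%N + w 2%N 1%N) *+ k *+ 2.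
Proof.
move=> wC; rewrite /arc_sum big_Rtree /= big_adj_root root_deg_root.
under eq_bigr => i _ do rewrite root_deg_middle.
under [in X in _ + X]eq_bigr => i _ do
  rewrite big_adj_middle big_adj_leaf root_deg_root root_deg_middle root_deg_leaf.
rewrite !sumr_const card_ord (wC 2%N k.+1) (wC 1%N 2%N) !mulrnDl mulr2n.
by rewrite !addrA; congr (_ + _); rewrite -!addrA; congr (_ + _); rewrite addrC.
Qed.

End Rtree.

Theorem theorem5p3 (R : realType) (n d : nat) (gamma : 'I_d -> rooted_graph)
    (KT : sgraph) (k : 'I_d -> nat) (p : R) :
  kragujevac gamma KT ->
  #|KT| = n ->
  (forall i, (2 <= k i)%N /\ rgiso (gamma i) (Rtree (k i))) ->
  0 < p ->
  albertson p KT =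
    ((n%:R - d%:R - 1) / 2
     + \sum_(i < d) ((k i)%:R * ((k i)%:R - 1) `^ p
                     + `|(k i)%:R - d%:R + 1| `^ p)) `^ p^-1.
Proof.
case=> _ _ _ [f fiso] <- gammaR _.
pose w a b : R := `|a%:R - b%:R| `^ p.
have wC : commutative w by move=> a b; rewrite /w distrC.
have cardKT : #|KT| = (\sum_i (k i).*2.+1).+1.
  rewrite (bij_eq_card fiso.1) card_join; congr _.+1; apply: eq_bigr => i _.
  by have [_ [g [gb _] _]] := gammaR i; rewrite (bij_eq_card gb) card_Rtree.
(* Twice the contribution of branch [i]. The isolated summand [(k i)%:R] comes from its pendant
   edges, each of weight [1]. *)
have degw i : w d (root_deg (root_of (gamma i))) *+ 2 + arc_sum w (@root_deg (gamma i)) =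
    (`|(k i)%:R - d%:R + 1| `^ p + (k i)%:R * ((k i)%:R - 1) `^ p + (k i)%:R) *+ 2.
  have [k2 [g giso grt]] := gammaR i.
  rewrite -(arc_sum_iso w giso (fun v => root_deg_iso v giso grt)).
  rewrite -(root_deg_iso _ giso grt) grt root_deg_root arc_sum_Rtree // wC.
  have -> : w (k i).+1 d = `|(k i)%:R - d%:R + 1| `^ p.
    by rewrite /w -natr1 addrAC.
  have -> : w (k i).+1 2%N = ((k i)%:R - 1) `^ p.
    (* This bound removes the absolute value from the difference of [(k i).+1] and [2]. *)
    have k1 : 1 <= (k i)%:R :> R by rewrite ler1n ltnW.
    by rewrite /w -natr1 (_ : _ - _ = (k i)%:R - 1) ?ger0_norm ?subr_ge0 //; ring.
  have -> : w 2%N 1%N = 1 by rewrite /w -natrB // normr1 powR1.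
  by rewrite -mulrnDl (mulrnDl (k i)) addrA mulr_natl.
rewrite /albertson; congr (_ `^ _).
have /(congr1 (fun x => x / 2)) := half_arc_sum (@deg KT) wC.
rewrite -(arc_sum_iso w fiso (fun v => deg_iso v fiso)) arc_sum_join //.
under [in X in _ = X / _]eq_bigr => i _ do rewrite degw.
have half2 (x : R) : x *+ 2 / 2 = x by rewrite -(mulr_natr x) mulfK ?pnatr_eq0.
rewrite sumrMnl !half2 => ->.
rewrite cardKT -natr1.
(* Hence n - d - 1 is twice the sum of the [k i], so the first term of the formula counts the
   pendant edges. *)
have -> : (\sum_i (k i).*2.+1 = (\sum_i k i) * 2 + d)%N.
  under eq_bigr => i _ do rewrite -addn1 -muln2.
  by rewrite big_split /= -big_distrl sum1_card card_ord.
have -> : ((\sum_i k i) * 2 + d)%:R + 1 - d%:R - 1 = (\sum_i (k i)%:R) *+ 2 :> R.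
  by rewrite natrD natrM -natr_sum; ring.
rewrite half2 -big_split /=.
by apply: eq_bigr => i _; ring.
Qed.
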